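(* Let $R$ be a $G$-graded commutative ring, $M$ a graded multiplication $R$-module, $N$ a graded $R$-submodule of $M$, and $s\in h^*(R)$. If $(N:_RM)\in GSpec_s(R)$, then $N\in GSpec_s({}_RM)$.
   Context: $G$ is a group with identity $e$; rings are commutative with nonzero unity $1$ and modules are unital. A ring $R$ is $G$-graded if $R=\bigoplus_{g\in G}R_g$ with additive subgroups $R_g$ satisfying $R_gR_h\subseteq R_{gh}$; $h(R)=\bigcup_{g\in G}R_g$ and $h^*(R)=h(R)\setminus\{0\}$. An $R$-module $M$ is $G$-graded if $M=\bigoplus_{g\in G}M_g$ with additive subgroups $M_g$ satisfying $R_gM_h\subseteq M_{gh}$; $h(M)=\bigcup_{g\in G}M_g$. A submodule $N$ of $M$ is graded if $N=\bigoplus_{g\in G}(N\cap M_g)$; graded ideals of $R$ are the graded submodules of $R$. Write $(N:_RM)=\{r\in R: rM\subseteq N\}$. A graded $R$-module $M$ is a graded multiplication module if $N=(N:_RM)M$ for every graded $R$-submodule $N$ of $M$. For $s\in h^*(R)$, a graded $R$-submodule $N$ of $M$ is graded $s$-prime if $s\notin(N:_RM)$ and, for all $r\in h(R)$ and $m\in h(M)$, $rm\in N$ implies $sr\in(N:_RM)$ or $sm\in N$. $GSpec_s({}_RM)$ is the set of graded $s$-prime $R$-submodules of $M$, and $GSpec_s(R)$ is the set of graded $s$-prime ideals of $R$ (graded ideals that are graded $s$-prime submodules of the $R$-module $R$). *)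

(* Defs.v *)
From mathcomp Require Import all_boot all_algebra.
From mathcomp Require Import boolp classical_sets functions cardinality fsbigop.

Set Implicit Arguments.
Unset Strict Implicit.
Unset Printing Implicit Defensive.
Import GRing.Theory.

Local Open Scope classical_set_scope.
Local Open Scope ring_scope.

(* Subsets are arbitrary Prop-valued sets; [mem] turns them into the
   (classical) boolean predicates expected by the MathComp closure notions. *)
Definition additive_subgroup (V : zmodType) (A : set V) : Prop :=
  zmod_closed (mem A).

Definition submodule (R : pzRingType) (M : lmodType R) (N : set M) : Prop :=
  submod_closed (mem N).

Definition direct_sum_carrier (I : Type) (V : zmodType) (A : I -> set V) :
    set (I -> V) :=
  [set f | (forall i, A i (f i)) /\ finite_set [set i | f i <> 0]].

(* B is the internal direct sum of the A i: summation is a bijection from the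
   external direct sum of the A i onto B. *)
Definition internal_direct_sum (I : choiceType) (V : zmodType)
    (A : I -> set V) (B : set V) : Prop :=
  set_bij (direct_sum_carrier A) B (fun f => \sum_(i \in [set: I]) f i).

Definition graded_ring (G : groupType) (R : comNzRingType)
    (Rg : G -> set R) : Prop :=
  [/\ forall g, additive_subgroup (Rg g),
      internal_direct_sum Rg [set: R]
    & forall (g h : G) (r t : R), Rg g r -> Rg h t -> Rg (g * h)%g (r * t)].

Definition graded_module (G : groupType) (R : comNzRingType)
    (Rg : G -> set R) (M : lmodType R) (Mg : G -> set M) : Prop :=
  [/\ forall g, additive_subgroup (Mg g),
      internal_direct_sum Mg [set: M]
    & forall (g h : G) (r : R) (m : M),
        Rg g r -> Mg h m -> Mg (g * h)%g (r *: m)].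

Definition homogeneous (G : groupType) (V : zmodType) (A : G -> set V) :
    set V :=
  \bigcup_(g in [set: G]) A g.

Definition nonzero_homogeneous (G : groupType) (V : zmodType)
    (A : G -> set V) : set V :=
  homogeneous A `\ 0.

Definition graded_submodule (G : groupType) (R : comNzRingType)
    (M : lmodType R) (Mg : G -> set M) (N : set M) : Prop :=
  submodule N /\ internal_direct_sum (fun g => N `&` Mg g) N.

Definition colon (R : comNzRingType) (M : lmodType R) (N : set M) : set R :=
  [set r | forall m : M, N (r *: m)].

(* The submodule I M: finite sums of products of elements of I and M. *)
Definition ideal_smul (R : comNzRingType) (M : lmodType R) (I : set R) :
    set M :=
  [set x | exists (n : nat) (r : 'I_n -> R) (m : 'I_n -> M),
     (forall i, I (r i)) /\ x = \sum_(i < n) r i *: m i].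

Definition graded_multiplication_module (G : groupType) (R : comNzRingType)
    (Rg : G -> set R) (M : lmodType R) (Mg : G -> set M) : Prop :=
  graded_module Rg Mg /\
  forall N : set M, graded_submodule Mg N -> N = ideal_smul (colon N).

Definition graded_s_prime (G : groupType) (R : comNzRingType)
    (Rg : G -> set R) (M : lmodType R) (Mg : G -> set M) (s : R)
    (N : set M) : Prop :=
  [/\ graded_submodule Mg N,
      ~ colon N s
    & forall (r : R) (m : M), homogeneous Rg r -> homogeneous Mg m ->
        N (r *: m) -> colon N (s * r) \/ N (s *: m)].

Definition GSpec (G : groupType) (R : comNzRingType)
    (Rg : G -> set R) (M : lmodType R) (Mg : G -> set M) (s : R) :
    set (set M) :=
  [set N | graded_s_prime Rg Mg s N].

(* R^o is R as a module over itself, graded by the same components. *)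
Definition GSpec_ring (G : groupType) (R : comNzRingType)
    (Rg : G -> set R) (s : R) : set (set R) :=
  @GSpec G R Rg R^o Rg s.

(* Main.v *)
(* For homogeneous m the cyclic module R m is graded, so R m = J M with
   J = (R m :_R M), and J contains the homogeneous components of its elements.
   If r m is in N with r homogeneous, then r J is contained in (N :_R M); when
   s r is not in (N :_R M), s-primeness of (N :_R M) against the homogeneous
   elements of J gives s J <= (N :_R M), whence s m is in s J M <= N. *)
Require Import Defs.
From mathcomp Require Import all_boot all_algebra.
From mathcomp Require Import finmap.
From mathcomp Require Import boolp classical_sets functions cardinality fsbigop.

Local Open Scope classical_set_scope.
Local Open Scope ring_scope.

Import GRing.Theory.

Set Implicit Arguments.
Unset Strict Implicit.
Unset Printing Implicit Defensive.

Section Submodules.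
Variables (R : pzRingType) (M : lmodType R) (N : set M).
Hypothesis subN : submodule N.

Lemma submodule0 : N 0.
Proof. by case: subN => + _; rewrite inE. Qed.

Lemma submoduleD x y : N x -> N y -> N (x + y).
Proof.
case: subN => _ linN Nx Ny; have := linN 1 x y.
by rewrite !inE scale1r; apply.
Qed.

Lemma submoduleZ a x : N x -> N (a *: x).
Proof.
case: subN => N0 linN Nx; have := linN a x 0 _ N0.
by rewrite !inE addr0; apply.
Qed.

Lemma submodule_sum (I : Type) (r : seq I) (F : I -> M) :
  (forall i, N (F i)) -> N (\sum_(i <- r) F i).
Proof.
move=> NF; elim/big_ind: _ => [|x y Nx Ny|i _]; last exact: NF.
- exact: submodule0.
- exact: submoduleD.
Qed.

End Submodules.

Lemma submodule_colon (R : comNzRingType) (M : lmodType R) (N : set M) :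
  submodule N -> @submodule R R^o (colon N).
Proof.
move=> subN; split; first by rewrite inE => m; rewrite scale0r; exact: submodule0.
move=> a u v; rewrite !inE => Nu Nv m; rewrite scalerDl -scalerA.
by apply: submoduleD => //; exact: submoduleZ.
Qed.

(* N is graded as soon as it contains the components of each of its elements:
   these components are the values of the unique f summing to the element. *)
Lemma graded_submoduleP (G : groupType) (R : comNzRingType) (M : lmodType R)
    (Mg : G -> set M) (N : set M) :
  internal_direct_sum Mg [set: M] -> submodule N ->
  graded_submodule Mg N <->
  forall f, direct_sum_carrier Mg f -> N (\sum_(i \in [set: G]) f i) ->
    forall g, N (f g).
Proof.
move=> [_ injM surM] subN; split=> [[_ [_ _ surN]] f Mf Nf g|compN].
  have [f' [NMf' finf'] f'E] := surN _ Nf.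
  suff -> : f = f' by case: (NMf' g).
  apply: injM; rewrite ?inE //.
  by split=> // i; case: (NMf' i).
split=> //; split.
- move=> f [NMf _]; apply: submodule_sum => // i; by case: (NMf i).
- move=> f f'; rewrite !inE => -[NMf finf] [NMf' finf']; apply: injM; rewrite inE.
    by split=> // i; case: (NMf i).
  by split=> // i; case: (NMf' i).
- move=> x Nx; have [f [Mf finf] fE] := surM x I.
  exists f => //; split=> // i; split=> //.
  by apply: compN => //; rewrite fE.
Qed.

Section GradedModules.
Variables (G : groupType) (R : comNzRingType) (Rg : G -> set R).
Variables (M : lmodType R) (Mg : G -> set M).
Hypotheses (gradR : graded_ring Rg) (gradM : graded_module Rg Mg).

(** For [m] of degree [h], this is the homogeneous decomposition of [r *: m], where [f] is that of
    [r]. [G] may be noncommutative, so [h] is cancelled on the right. *)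
Definition shift_components (h : G) (f : G -> R) (m : M) (k : G) : M :=
  f (k * h^-1)%g *: m.

Lemma shift_components_carrier h f m :
  direct_sum_carrier Rg f -> Mg h m ->
  direct_sum_carrier Mg (shift_components h f m).
Proof.
case: gradM => _ _ gradZ [Rf finf] Mm; split=> [k|].
  by rewrite -[k in Mg k](mulgVK h); exact: gradZ.
apply: (@sub_finite_set _ _ ((fun k => k * h)%g @` [set i | f i <> 0])).
  move=> k /= fm0; exists (k * h^-1)%g; last exact: mulgVK.
  by move=> f0; apply: fm0; rewrite /shift_components f0 scale0r.
exact: finite_image.
Qed.

Lemma sum_shift_components h f m :
  direct_sum_carrier Rg f ->
  \sum_(k \in [set: G]) shift_components h f m k =
  (\sum_(g \in [set: G]) f g) *: m.
Proof.
move=> [_ finf].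
(* Right translation by [h] undoes the shift. Some [f i *: m] may vanish with [f i] nonzero, so both
   sums are then taken over the support [A] of [f]. *)
rewrite (reindex_fsbigT (fun k : G => k * h)%g); last first.
  by exists (fun k => k * h^-1)%g => k; rewrite ?mulgK ?mulgVK.
pose A := fset_set [set i | f i <> 0].
have fA i : i \notin A -> f i = 0.
  by rewrite in_fset_set // notin_setE /= => /contrapT.
rewrite (fsbigTE A f fA) scaler_suml (fsbigTE A).
  by apply: eq_bigr => i _; rewrite /shift_components mulgK.
by move=> i /fA; rewrite /shift_components mulgK => ->; rewrite scale0r.
Qed.

(** By additivity it is enough to test [f g] on homogeneous components of [m]; on one of degree [h],
    [f g] yields the component of degree [g * h] of an element of the graded submodule [K]. *)
Lemma colon_component (K : set M) f g :
  graded_submodule Mg K -> direct_sum_carrier Rg f ->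
  colon K (\sum_(i \in [set: G]) f i) -> colon K (f g).
Proof.
case: gradM => _ dsM _ gradK Rf Kf m; have [subK _] := gradK.
have [_ _ /(_ m I) [n [Mn _] <-]] := dsM.
rewrite scaler_sumr; apply: submodule_sum => // h.
have /(graded_submoduleP dsM subK) compK := gradK.
have := compK _ (shift_components_carrier Rf (Mn h)) _ (g * h)%g.
rewrite sum_shift_components // /shift_components mulgK; apply; exact: Kf.
Qed.

Lemma submodule_cyclic (m : M) : submodule (range (fun r : R => r *: m)).
Proof.
split; first by rewrite inE; exists 0; rewrite ?scale0r.
move=> a u v; rewrite !inE => -[r _ <-] [t _ <-].
by exists (a * r + t); rewrite // scalerDl scalerA.
Qed.

(** By uniqueness of decompositions, the components of [r *: m] are components of [r] times [m],
    hence again multiples of [m]. *)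
Lemma graded_cyclic h m :
  Mg h m -> graded_submodule Mg (range (fun r : R => r *: m)).
Proof.
case: gradR gradM => _ [_ _ surR] _ [_ dsM _] Mm.
apply/(graded_submoduleP dsM (submodule_cyclic m)) => f Mf [r _] rmE g.
have [c Rc cE] := surR r I.
have -> : f = shift_components h c m; last by exists (c (g * h^-1)%g).
case: dsM => _ injM _; apply: injM; rewrite ?inE //.
  exact: shift_components_carrier.
by rewrite sum_shift_components // cE rmE.
Qed.

End GradedModules.

Theorem proposition2p8 (G : groupType) (R : comNzRingType) (Rg : G -> set R)
    (hR : graded_ring Rg) (M : lmodType R) (Mg : G -> set M)
    (hM : graded_multiplication_module Rg Mg)
    (N : set M) (hN : graded_submodule Mg N)
    (s : R) (hs : nonzero_homogeneous Rg s) :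
  GSpec_ring Rg s (colon N) -> GSpec Rg Mg s N.
Proof.
case: hM => gradM multM [_ sNcolon primeN]; have [subN _] := hN.
split=> // [Ns|r m hr [h _ Mm] Nrm].
  by apply: sNcolon => t x; rewrite -scalerA; exact: Ns.
apply: contrapT => /not_orP[Nsr Nsm]; apply: Nsm.
set K := range (fun t : R => t *: m).
have gradK : graded_submodule Mg K by exact: (graded_cyclic hR gradM Mm).
have [n [j [x [Kj mE]]]] : ideal_smul (colon K) m.
  by rewrite -multM //; exists 1; rewrite ?scale1r.
have sK t : colon K t -> colon N (s * t).
  have [_ [_ _ surR] _] := hR.
  have [f Rf <-] := surR t I; move=> Kf; rewrite mulr_sumr.
  apply: (submodule_sum (submodule_colon subN)) => g.
  have Kfg : colon K (f g) by exact: (colon_component gradM g gradK Rf Kf).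
  have hfg : homogeneous Rg (f g) by case: Rf => Rf _; exists g.
  (* The product [r * f g] lies in [colon N]: [f g *: y] is some [a *: m], and
     [r *: (a *: m) = a *: (r *: m)] is in [N]. *)
  case: (primeN r (f g) hr hfg) => // [y|srN].
    have [a _ aE] := Kfg y.
    rewrite -scalerA -aE scalerA mulrC -scalerA; exact: submoduleZ.
  (* The other alternative puts every multiple of [s * r] in [colon N]; the multiple by 1
     contradicts [Nsr]. *)
  by case: Nsr; rewrite -[s * r]mulr1; exact: srN.
rewrite mE scaler_sumr; apply: submodule_sum => // i.
by rewrite scalerA; exact: sK.
Qed.
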